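(* Fix a real number $\rho>0$ and an integer $N\ge1$. Let $\mathbf{c}:=(c_0,\dots,c_{N-1})\in(0,\infty)^N$, and suppose $g(z):=\sum_{M=N}^\infty c_Mz^M$ is analytic on $D(0,\rho)$ and continuous on $\overline{D}(0,\rho)$, with real coefficients. Then $$t\bigl(c_0\mathbf{1}_{N\times N}+c_1A+\cdots+c_{N-1}A^{\circ(N-1)}\bigr)-g[A]\in\mathcal{P}_N(\mathbb{C})$$ for all $A\in\mathcal{P}_N(\overline{D}(0,\rho))$ and all $$t\ge\sum_{M\ge N:\,c_M>0}c_M\,\mathcal{C}(\mathbf{c};z^M;N,\rho).$$ Moreover, this series is convergent, being bounded above by $$\frac{g_2^{(2N-2)}(\sqrt{\rho})}{2^{N-1}\,((N-1)!)^2}\sum_{j=0}^{N-1}\binom{N-1}{j}^2\frac{\rho^{N-j-1}}{c_j},$$ where $g_2(z):=g_+(z^2)$ and $g_+(z):=\sum_{M\ge N:\,c_M>0}c_Mz^M$.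
   Context: $D(0,\rho)$ and $\overline{D}(0,\rho)$ are the open and closed discs in $\mathbb{C}$ with center $0$ and radius $\rho$. $\mathcal{P}_N(K)$ is the set of positive semidefinite $N\times N$ matrices with entries in $K\subset\mathbb{C}$. $g[A]:=(g(a_{ij}))$ is the entrywise application of $g$ to $A=(a_{ij})$; $A^{\circ k}:=(a_{ij}^k)$ is the $k$th Hadamard (entrywise) power; $\mathbf{1}_{N\times N}$ is the $N\times N$ matrix with all entries $1$; $g_2^{(2N-2)}$ is the $(2N-2)$th derivative of $g_2$. For $M\ge N$ and $c_0,\dots,c_{N-1}>0$, $$\mathcal{C}(\mathbf{c};z^M;N,\rho):=\sum_{j=0}^{N-1}\binom{M}{j}^2\binom{M-j-1}{N-j-1}^2\frac{\rho^{M-j}}{c_j}.$$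
   Formalization: The series is claimed convergent only when g_2^{(2N-2)}(√ρ), read as the limit from the left in [0,∞], is finite; the bound is stated in extended reals. Unconditionally it fails: ρ=1, N=2, c_M=1/M² for M≥2. *)

(* Defs.v *)
From mathcomp Require Export all_boot all_order all_algebra.
From mathcomp Require Export all_classical all_reals all_analysis.
From mathcomp Require Export complex.
Set Implicit Arguments.
Unset Strict Implicit.
Unset Printing Implicit Defensive.
Import Order.TTheory GRing.Theory Num.Theory.
Import numFieldNormedType.Exports.
Local Open Scope classical_set_scope.
Local Open Scope sesquilinear_scope.
Local Open Scope complex_scope.
Local Open Scope ring_scope.

Definition open_disc (R : realType) (rho : R) : set R[i]^o :=
  [set z | `|z| < rho%:C].

Definition closed_disc (R : realType) (rho : R) : set R[i]^o :=
  [set z | `|z| <= rho%:C].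

(* In R[i], [0 <= w] means that w is real and nonnegative. *)
Definition psdmx (R : realType) (N : nat) (A : 'M[R[i]]_N) : Prop :=
  A \is hermsymmx /\
  forall v : 'cV[R[i]]_N, 0 <= (v^t* *m A *m v) ord0 ord0.

Definition psd_over (R : realType) (N : nat) (K : set R[i]) :
    set 'M[R[i]]_N :=
  [set A | psdmx A /\ forall i j, K (A i j)].

Definition hadamard_pow (R : realType) (N : nat) (A : 'M[R[i]]_N) (k : nat) :
    'M[R[i]]_N :=
  map_mx (fun z => z ^+ k) A.

(* \mathcal{C}(c; z^M; N, rho) *)
Definition threshold (R : realType) (c : nat -> R) (M N : nat) (rho : R) : R :=
  \sum_(j < N) ('C(M, j) ^ 2)%:R * ('C(M - j - 1, N - j - 1) ^ 2)%:R
               * (rho ^+ (M - j) / c j).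

(* g(z) = sum_(M >= N) c_M z^M on the open disc.  Convergence of a power
   series on D(0, rho) makes its sum analytic there; on the boundary circle
   only the continuity of g is required, not convergence of the series. *)
Definition analytic_series (R : realType) (c : nat -> R) (N : nat) (rho : R)
    (g : R[i]^o -> R[i]^o) : Prop :=
  forall z : R[i]^o, open_disc rho z ->
    (fun n : nat => (\sum_(N <= M < n) (c M)%:C * z ^+ M : R[i]^o)) @ \oo
      --> g z.

(* The restriction of g_+ to the real axis. *)
Definition gplus (R : realType) (c : nat -> R) (N : nat) (x : R) : R :=
  limn (fun n : nat => \sum_(N <= M < n | 0 < c M) c M * x ^+ M).

Definition g2 (R : realType) (c : nat -> R) (N : nat) (x : R) : R :=
  gplus c N (x ^+ 2).

(* g_2^{(k)} on the real axis, as an extended real. *)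
Definition g2_deriv (R : realType) (c : nat -> R) (N k : nat) (x : R) : \bar R :=
  (derive1n k (g2 c N) x)%:E.

(* sqrt rho may lie on the boundary of the domain of analyticity of g_2, so
   g_2^{(k)}(sqrt rho) is the limit from inside, in [0, +oo]; it is the
   ordinary derivative at sqrt rho when g_+ is analytic near rho. *)
Definition g2_deriv_sqrt (R : realType) (c : nat -> R) (N k : nat) (rho : R) :
    \bar R :=
  lim (g2_deriv c N k x @[x --> (Num.sqrt rho)^'-]).

(* Main.v *)
Require Import Defs.
From mathcomp Require Import ring lra zify.
From mathcomp Require Import polyrcf.
Import Order.TTheory GRing.Theory Num.Theory.
Import numFieldNormedType.Exports.
Local Open Scope classical_set_scope.
Local Open Scope complex_scope.
Local Open Scope ring_scope.

(** Write [q = c_0 + ... + c_(N-1) z^(N-1)].  The heart of the matter is the case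
    of one monomial: if [A] is positive semidefinite of size [N] with diagonal
    entries at most [rho], and [M >= N], then [t q[A] - A^(o M)] is positive
    semidefinite as soon as [t] is at least the threshold [C(c; z^M; N, rho)].

    For a rank one matrix [A = u u^*] this is an interpolation estimate.  The
    polynomial of degree less than [N] that agrees with [z^M] at the [u_i] has,
    up to sign, hook Schur polynomials of the [u_i] as coefficients; they have
    nonnegative coefficients, hence are largest when all the [u_i] equal
    [sqrt rho], where they take the value
    [binom(M, j) binom(M-j-1, N-j-1) rho^((M-j)/2)].  Replacing [u_i^M] by the
    interpolant in [|sum_i v_i^* u_i^M|^2] and using the Cauchy-Schwarz
    inequality with weights [c_j] gives the threshold
    ([interpolation_pow], [posform_rank1_pow]).

    The general case follows by the argument of FitzGerald and Horn.  Let
    [f = t q - z^M], let [f[A]] be its entrywise application, and split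
    [A = z z^* + B] with [z z^*] proportional to the first column times the first
    row of [A]: then [B] is a bordered Schur complement.  Along the segment
    [z z^* + x B], the derivative in [x] of the value of [f] is the Hadamard
    product of [B] with the value of [f'].  It is positive semidefinite by the
    Schur product theorem and by induction on [N], because [B] lives on a block of
    size [N-1] and because differentiating lowers the threshold
    ([hook_threshold_deriv]).  So [f[A]] dominates [f[z z^*]], which is the rank
    one case ([posform_monomial]).

    A power series is handled by summing over the monomials: those with a
    positive coefficient cost [c_M] times their threshold, the others only help.
    One truncates, evaluates at [s A] with [s < 1], and passes to the limit,
    first in the truncation, then for [s] tending to 1; the second limit uses only
    the continuity of [g] on the closed disc ([posform_series]).

    For the bound on the series of thresholds, on the interval
    [(0, sqrt rho)] the derivatives of [g_2] are power series with nonnegative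
    coefficients, hence nondecreasing, so they have a limit at [sqrt rho] in the
    extended reals ([cvg_g2_deriv]) that dominates every partial sum evaluated at
    [sqrt rho] ([g2_partial_le_lim]).  These partial sums are compared with
    those of the thresholds term by term ([threshold_bound]). *)

Set Implicit Arguments.
Unset Strict Implicit.
Unset Printing Implicit Defensive.

(** * Positive semidefinite forms *)

Section PositiveForms.
Variable C : numClosedFieldType.
Implicit Types n m : nat.

Definition form n (A : 'I_n -> 'I_n -> C) (v : 'I_n -> C) : C :=
  \sum_i \sum_j (v i)^* * v j * A i j.

(** Positive semidefiniteness without the Hermitian symmetry, which follows
    ([posform_herm]); limits are then immediate.  Entries are given by a function
    because all the operations involved are entrywise. *)
Definition posform n (A : 'I_n -> 'I_n -> C) : Prop := forall v, 0 <= form A v.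

Lemma eq_form n (A B : 'I_n -> 'I_n -> C) v w :
  (forall i j, (v i)^* * v j * A i j = (w i)^* * w j * B i j) -> form A v = form B w.
Proof. by move=> AB; apply: eq_bigr => i _; apply: eq_bigr => j _. Qed.

Lemma eq_posform n (A B : 'I_n -> 'I_n -> C) :
  (forall i j, A i j = B i j) -> posform A -> posform B.
Proof. by move=> AB pA v; rewrite -(eq_form (A := A) (v := v)) // => i j; rewrite AB. Qed.

Lemma formD n (A B : 'I_n -> 'I_n -> C) v :
  form (fun i j => A i j + B i j) v = form A v + form B v.
Proof.
rewrite -big_split; apply: eq_bigr => i _; rewrite -big_split.
by apply: eq_bigr => j _; rewrite mulrDr.
Qed.

Lemma posformD n (A B : 'I_n -> 'I_n -> C) :
  posform A -> posform B -> posform (fun i j => A i j + B i j).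
Proof. by move=> pA pB v; rewrite formD addr_ge0 ?pA ?pB. Qed.

Lemma formZ n a (A : 'I_n -> 'I_n -> C) v :
  form (fun i j => a * A i j) v = a * form A v.
Proof.
rewrite mulr_sumr; apply: eq_bigr => i _; rewrite mulr_sumr.
by apply: eq_bigr => j _; rewrite mulrCA.
Qed.

Lemma formB n (A B : 'I_n -> 'I_n -> C) v :
  form (fun i j => A i j - B i j) v = form A v - form B v.
Proof.
rewrite -sumrB; apply: eq_bigr => i _; rewrite -sumrB.
by apply: eq_bigr => j _; rewrite mulrBr.
Qed.

Lemma form_sum n (I : Type) (r : seq I) (P : pred I) (F : I -> 'I_n -> 'I_n -> C) v :
  form (fun i j => \sum_(k <- r | P k) F k i j) v =
  \sum_(k <- r | P k) form (F k) v.
Proof.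
rewrite [RHS]exchange_big; apply: eq_bigr => i _.
by rewrite [RHS]exchange_big; apply: eq_bigr => j _; rewrite mulr_sumr.
Qed.

Lemma posformZ n a (A : 'I_n -> 'I_n -> C) :
  0 <= a -> posform A -> posform (fun i j => a * A i j).
Proof. by move=> a0 pA v; rewrite formZ mulr_ge0 ?pA. Qed.

Lemma posform_sum n (I : Type) (r : seq I) (P : pred I) (F : I -> 'I_n -> 'I_n -> C) :
  (forall k, P k -> posform (F k)) ->
  posform (fun i j => \sum_(k <- r | P k) F k i j).
Proof. by move=> pF v; rewrite form_sum sumr_ge0 // => k Pk; apply: pF. Qed.

Lemma form_rank1 n (u v : 'I_n -> C) :
  form (fun i j => u i * (u j)^*) v = `|\sum_i (v i)^* * u i| ^+ 2.
Proof.
rewrite normCK rmorph_sum /= mulr_suml; apply: eq_bigr => i _.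
rewrite mulr_sumr; apply: eq_bigr => j _; rewrite rmorphM /= conjCK; ring.
Qed.

Lemma posform_rank1 n (u : 'I_n -> C) : posform (fun i j => u i * (u j)^*).
Proof. by move=> v; rewrite form_rank1 exprn_ge0. Qed.

(** Covers principal submatrices, and with [m = 2] the evaluation on vectors
    supported by two coordinates. *)
Lemma posform_pull m n (f : 'I_m -> 'I_n) (A : 'I_n -> 'I_n -> C) :
  posform A -> posform (fun k l => A (f k) (f l)).
Proof.
move=> pA v; have := pA (fun i => \sum_(k | f k == i) v k); congr (_ <= _).
rewrite /form (partition_big f xpredT) //=; apply: eq_bigr => i _.
under [RHS]eq_bigr => k /eqP -> do rewrite (partition_big f xpredT) //=.
rewrite exchange_big; apply: eq_bigr => j _ /=.
rewrite rmorph_sum /= !mulr_suml; apply: eq_bigr => k _.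
rewrite mulr_sumr mulr_suml.
by apply: eq_bigr => l /eqP ->.
Qed.

Lemma posform2 n (A : 'I_n -> 'I_n -> C) (i j : 'I_n) (x y : C) :
  posform A ->
  0 <= x^* * x * A i i + x^* * y * A i j + y^* * x * A j i + y^* * y * A j j.
Proof.
move=> pA; have := @posform_pull 2 n (fun k => if k == ord0 then i else j) A pA
  (fun k => if k == ord0 then x else y).
by rewrite /form !big_ord_recl !big_ord0 /= !addr0 !addrA.
Qed.

Lemma posform_diag n (A : 'I_n -> 'I_n -> C) i : posform A -> 0 <= A i i.
Proof.
move=> pA; have := posform2 i i 1 0 pA.
by rewrite conjC1 conjC0 !mul0r mulr0 mul0r !addr0 !mul1r.
Qed.

(** Over the complex numbers positivity of the form forces the symmetry: the
    values at [e_i + e_j] and at [e_i + 'i e_j] are real. *)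
Lemma posform_herm n (A : 'I_n -> 'I_n -> C) i j : posform A -> A j i = (A i j)^*.
Proof.
move=> pA; have rj := ger0_real (posform_diag j pA).
have ri := ger0_real (posform_diag i pA).
have := ger0_real (posform2 i j 1 1 pA).
have := ger0_real (posform2 i j 1 'i pA).
move=> /CrealP + /CrealP.
rewrite !rmorphD !rmorphM /= !conjCK !conjC1 conjCi (CrealP ri) (CrealP rj).
move=> h1 h2; have inz : 'i != 0 :> C := neq0Ci C.
apply/eqP; rewrite -subr_eq0; apply/eqP.
apply: (mulfI inz); apply: (mulfI (_ : 2 != 0 :> C)); first by rewrite pnatr_eq0.
rewrite !mulr0.
(* the difference of the sides of [h1], minus ['i] times that of [h2] *)
apply: (eq_trans (y :=
  (1 * 1 * A i i + 1 * - 'i * (A i j)^* + 'i * 1 * (A j i)^* + 'i * - 'i * A j j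
   - (1 * 1 * A i i + 1 * 'i * A i j + - 'i * 1 * A j i + - 'i * 'i * A j j))
  - 'i *
  (1 * 1 * A i i + 1 * 1 * (A i j)^* + 1 * 1 * (A j i)^* + 1 * 1 * A j j
   - (1 * 1 * A i i + 1 * 1 * A i j + 1 * 1 * A j i + 1 * 1 * A j j)))).
  ring.
by rewrite h1 h2 !subrr mulr0 subrr.
Qed.

Lemma posform_diag0 n (A : 'I_n -> 'I_n -> C) i j :
  posform A -> A i i = 0 -> A i j = 0.
Proof.
move=> pA Aii; apply/eqP/negPn/negP => b0.
have n0 : `|A i j| ^+ 2 != 0 by rewrite expf_eq0 normr_eq0.
(* with this [s], the form at [- s A_ij e_i + e_j] is [- (A_jj + 2)] *)
pose s := (A j j + 1) / `|A i j| ^+ 2.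
have sr : s^* = s.
  by apply/CrealP/ger0_real; rewrite divr_ge0 ?exprn_ge0 // addr_ge0 ?posform_diag.
have := posform2 i j (- (s * A i j)) 1 pA.
rewrite (posform_herm i j pA) Aii rmorphN rmorphM /= sr conjC1 !mul1r mulr0 add0r.
rewrite mulr1 mulNr.
have sE : s * `|A i j| ^+ 2 = A j j + 1 by rewrite /s divfK.
have -> : - (s * (A i j)^* * A i j) = - (A j j + 1) by rewrite -sE normCK; ring.
have -> : - (s * A i j) * (A i j)^* = - (A j j + 1) by rewrite -sE normCK; ring.
have -> : - (A j j + 1) - (A j j + 1) + A j j = - (A j j + 2) by ring.
by rewrite oppr_ge0 lt_geF // ltr_wpDl ?posform_diag.
Qed.

Definition border n (S : 'I_n -> 'I_n -> C) (i j : 'I_n.+1) : C :=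
  if unlift ord0 i is Some i' then
    if unlift ord0 j is Some j' then S i' j' else 0
  else 0.

Lemma sum_border n (S : 'I_n -> 'I_n -> C) (F : 'I_n.+1 -> 'I_n.+1 -> C) :
  \sum_i \sum_j F i j * border S i j =
  \sum_i \sum_j F (lift ord0 i) (lift ord0 j) * S i j.
Proof.
rewrite big_ord_recl big1 ?add0r => [|j _]; last by rewrite /border unlift_none mulr0.
apply: eq_bigr => i _; rewrite big_ord_recl {1}/border liftK unlift_none mulr0 add0r.
by apply: eq_bigr => j _; rewrite /border !liftK.
Qed.

Definition schur_compl n (A : 'I_n.+1 -> 'I_n.+1 -> C) (i j : 'I_n) : C :=
  A (lift ord0 i) (lift ord0 j) -
  A (lift ord0 i) ord0 * A ord0 (lift ord0 j) / A ord0 ord0.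

(** When the corner entry is zero, so are its row and its column, and the
    quotient by zero then contributes nothing, as it should. *)
Lemma schur_complE n (A : 'I_n.+1 -> 'I_n.+1 -> C) i j : posform A ->
  A i j = A i ord0 * A ord0 j / A ord0 ord0 + border (schur_compl A) i j.
Proof.
move=> pA; have [a0|a0] := eqVneq (A ord0 ord0) 0.
  have z k : A ord0 k = 0 by apply: posform_diag0.
  have z' k : A k ord0 = 0 by rewrite (posform_herm ord0 k) // z conjC0.
  rewrite /border /schur_compl z mulr0 mul0r add0r.
  case: unliftP => [i'|] -> //.
  by case: unliftP => [j'|] -> //; rewrite z mulr0 mul0r subr0.
rewrite /border /schur_compl.
case: unliftP => [i'|] ->; last by rewrite addr0 mulrAC divff // mul1r.
by case: unliftP => [j'|] ->; [rewrite addrC subrK | rewrite addr0 mulfK].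
Qed.

(** The form of the complement at [v] is the form of [A] at the vector that
    extends [v] by the coordinate minimizing it, which is [- s / a]. *)
Lemma posform_schur_compl n (A : 'I_n.+1 -> 'I_n.+1 -> C) :
  posform A -> posform (schur_compl A).
Proof.
move=> pA v; set a := A ord0 ord0.
pose s := \sum_j A ord0 (lift ord0 j) * v j.
pose w i := if unlift ord0 i is Some i' then v i' else - s / a.
have ar : a^* = a by apply/CrealP/ger0_real/posform_diag.
have sC : s^* = \sum_i (v i)^* * A (lift ord0 i) ord0.
  rewrite rmorph_sum; apply: eq_bigr => i _.
  by rewrite rmorphM /= mulrC (posform_herm ord0 _ pA).
have := pA w; rewrite /form big_ord_recl big_ord_recl /w unlift_none -/a.
rewrite rmorphM rmorphN fmorphV /= ar.
under eq_bigr => j _ do rewrite liftK -mulrA [v j * _]mulrC.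
rewrite -mulr_sumr -/s.
under [X in _ + _ + X]eq_bigr => i _.
  rewrite big_ord_recl unlift_none liftK.
  under eq_bigr => j _ do rewrite liftK.
  rewrite mulrAC.
  over.
rewrite big_split /= -mulr_suml -sC.
have -> : \sum_i \sum_j (v i)^* * v j * schur_compl A i j =
  \sum_i \sum_j (v i)^* * v j * A (lift ord0 i) (lift ord0 j) - s^* * s / a.
  rewrite sC mulr_suml mulr_suml -sumrB; apply: eq_bigr => i _.
  rewrite /s mulr_sumr mulr_suml -sumrB; apply: eq_bigr => j _.
  by rewrite /schur_compl mulrBr; congr (_ - _); rewrite -/a; ring.
congr (_ <= _); set Q := \sum_i \sum_j _.
have [a0|a0] := eqVneq a 0.
  by rewrite a0 invr0 !(mulr0, mul0r, add0r, subr0).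
by field.
Qed.

(** Schur product theorem.  The rank one part of [A] rescales the vector at
    which the form of [B] is taken, and the Schur complement of [A] reduces the
    size by one. *)
Lemma posformM n (A B : 'I_n -> 'I_n -> C) :
  posform A -> posform B -> posform (fun i j => A i j * B i j).
Proof.
elim: n A B => [|n IHn] A B pA pB v; first by rewrite /form big_ord0.
have -> : form (fun i j => A i j * B i j) v =
  (A ord0 ord0)^-1 * form B (fun j => v j * A ord0 j) +
  form (fun i j => schur_compl A i j * B (lift ord0 i) (lift ord0 j))
     (fun i => v (lift ord0 i)).
  transitivity (\sum_i \sum_j
    ((A ord0 ord0)^-1 * ((v i * A ord0 i)^* * (v j * A ord0 j) * B i j)
     + (v i)^* * v j * B i j * border (schur_compl A) i j)).
    apply: eq_bigr => i _; apply: eq_bigr => j _.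
    rewrite {1}(schur_complE i j pA) (posform_herm ord0 i pA) rmorphM /=; ring.
  under eq_bigr do rewrite big_split /=.
  rewrite big_split /= sum_border -/(form _ _); congr (_ + _).
    by rewrite mulr_sumr; apply: eq_bigr => i _; rewrite mulr_sumr.
  by apply: eq_bigr => i _; apply: eq_bigr => j _; rewrite -mulrA [B _ _ * _]mulrC.
apply: addr_ge0; first by rewrite mulr_ge0 ?invr_ge0 ?posform_diag.
apply: IHn; first exact: posform_schur_compl.
exact: posform_pull.
Qed.

Lemma posform1 n : posform (fun _ _ : 'I_n => 1).
Proof.
by apply: eq_posform (posform_rank1 (fun _ => 1)) => i j; rewrite conjC1 mulr1.
Qed.

Lemma posformX n (A : 'I_n -> 'I_n -> C) k :
  posform A -> posform (fun i j => A i j ^+ k).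
Proof.
move=> pA; elim: k => [|k IHk].
  by apply: eq_posform (@posform1 n) => i j; rewrite expr0.
by apply: eq_posform (posformM pA IHk) => i j; rewrite exprS.
Qed.

End PositiveForms.

(** * Interpolation of a power and the rank one case *)

(** Value at [(1, ..., 1)] of the Schur polynomial in [N] variables of the hook
    with arm [M - N] and leg [N - j - 1], for [j < N <= M]. *)
Definition hook_dim (M N j : nat) : nat := 'C(M, j) * 'C(M - j - 1, N - j - 1).

(** Mirrors the recursion for the interpolants used in [interpolation_pow]. *)
Lemma hook_dim_rec M n j : (j < n.+1)%N -> (n <= M)%N ->
  hook_dim M.+1 n.+1 j =
  (hook_dim M n.+1 j + (if j is j'.+1 then hook_dim M n j' else 0)
   + (if (j < n)%N then hook_dim M n j else 0))%N.
Proof.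
rewrite /hook_dim => jn nM.
have [ltjn|lejn] := ltnP j n.
- have -> : (M.+1 - j - 1 = (M - j - 1).+1)%N by lia.
  have -> : (n.+1 - j - 1 = (n - j - 1).+1)%N by lia.
  rewrite binS; case: j jn ltjn => [|j] jn ltjn; first by rewrite !bin0; lia.
  have -> : (M - j - 1 = (M - j.+1 - 1).+1)%N by lia.
  have -> : (n - j - 1 = (n - j.+1 - 1).+1)%N by lia.
  by rewrite !binS; lia.
have -> : j = n by lia.
have -> : (n.+1 - n - 1 = 0)%N by lia.
rewrite !bin0; case: n {jn nM lejn} => [|n]; first by rewrite !bin0.
have -> : (n.+1 - n - 1 = 0)%N by lia.
by rewrite !bin0 binS; lia.
Qed.

Section Interpolation.
Variable F : numFieldType.

(** With [p_(M,s)] the interpolant of [z^M] at [s], one has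
    [p_(M+1,x::s) = x p_(M,x::s) + ('X - x) p_(M,s)].  The coefficients of the two
    summands at a given degree have the same sign when the nodes are positive:
    nothing cancels, and the triangle inequality is sharp at equal nodes.  The
    obvious recursion, multiplication by [z] followed by reduction, lacks this
    property. *)
Lemma interpolation_pow (r : F) (s : seq F) (M : nat) :
  all (fun x => `|x| <= r) s -> (size s <= M.+1)%N ->
  exists p : {poly F}, [/\ (size p <= size s)%N,
    forall x, x \in s -> p.[x] = x ^+ M &
    forall j, (j < size s)%N ->
      `|p`_j| <= (hook_dim M (size s) j)%:R * r ^+ (M - j)].
Proof.
elim: s M => [|x s IHs] M /=.
  by move=> _ _; exists 0; split=> //; rewrite size_poly0.
case/andP => xr sr; set n := size s; rewrite ltnS.
have r0 : 0 <= r by apply: le_trans xr.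
elim: M => [|M IHM] nM.
  have s0 : s = [::] by apply/size0nil/eqP; rewrite -leqn0.
  exists 1; rewrite /n s0 size_poly1; split=> //; first by move=> y _; rewrite hornerC.
  by case=> // _; rewrite coef1 /hook_dim normr1 mul1r.
have [nM'|nM'] := leqP n M; last first.
  (* base case: there are more nodes than the exponent, so [z^M] interpolates *)
  have nE : n = M.+1 by apply/eqP; rewrite eqn_leq nM.
  exists 'X^n; rewrite size_polyXn; split=> //.
    by move=> y _; rewrite hornerXn nE.
  move=> j jn.
  rewrite coefXn; have [->|jnE] := eqVneq j n.
    rewrite nE subnn expr0 mulr1 normr1 /hook_dim binn mul1n.
    by rewrite (_ : (M.+2 - M.+1 - 1 = 0)%N) ?bin0 //; lia.
  by rewrite normr0 mulr_ge0 ?exprn_ge0.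
have [p [sp pE pb]] := IHM nM'.
have [q [sq qE qb]] := IHs M sr (leqW nM').
exists (x *: p + ('X - x%:P) * q); split.
- rewrite (leq_trans (size_polyD _ _)) // geq_max (leq_trans (size_scale_leq _ _)) //=.
  by rewrite (leq_trans (size_polyMleq _ _)) // size_XsubC.
- move=> y; rewrite inE !hornerE => /orP[/eqP->|ys].
    by rewrite pE ?mem_head // subrr mul0r addr0 exprS.
  by rewrite pE ?inE ?ys ?orbT // qE // exprS; ring.
move=> j jn; have jM : (j <= M)%N by apply: leq_trans nM'; rewrite -ltnS.
rewrite (hook_dim_rec jn) // coefD coefZ mulrBl coefB coefXM coefCM.
rewrite addrA !natrD !mulrDl (le_trans (ler_normB _ _)) // lerD //.
  rewrite (le_trans (ler_normD _ _)) // lerD //.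
    rewrite normrM subSn // exprS mulrCA.
    by rewrite ler_pM ?normr_ge0 // pb.
  case: j jn jM => [|j] jn jM /=; first by rewrite normr0 mul0r.
  by rewrite subSS qb.
case: ifPn => [ltjn|]; last first.
  rewrite -leqNgt => nj; rewrite nth_default ?(leq_trans sq) //.
  by rewrite mulr0 normr0 mul0r.
by rewrite normrM subSn // exprS mulrCA ler_pM ?normr_ge0 // qb.
Qed.

(** Lagrange's identity: twice the difference is a double sum of squares. *)
Lemma cauchy_schwarz_sum (I : finType) (a b : I -> F) :
  (forall i, 0 <= a i) -> (forall i, 0 <= b i) ->
  (\sum_i a i * b i) ^+ 2 <= (\sum_i a i ^+ 2) * (\sum_i b i ^+ 2).
Proof.
move=> a0 b0; rewrite -subr_ge0.
rewrite -(pmulr_rge0 _ (ltr0n F 2)).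
have -> : 2 * ((\sum_i a i ^+ 2) * (\sum_i b i ^+ 2) - (\sum_i a i * b i) ^+ 2)
  = \sum_i \sum_j (a i * b j - a j * b i) ^+ 2.
  have prodE (f g : I -> F) : (\sum_i f i) * (\sum_j g j) = \sum_i \sum_j f i * g j.
    by rewrite mulr_suml; apply: eq_bigr => i _; rewrite mulr_sumr.
  rewrite mulrBr mulr2n !mulrDl !mul1r.
  rewrite {2}[(\sum_i _) * (\sum_i _)]mulrC expr2 !prodE -!big_split -sumrB /=.
  apply: eq_bigr => i _; rewrite -!big_split -sumrB /=.
  by apply: eq_bigr => j _; ring.
apply: sumr_ge0 => i _; apply: sumr_ge0 => j _.
by rewrite real_exprn_even_ge0 // realB ?ger0_real ?mulr_ge0.
Qed.

End Interpolation.

Section RankOne.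
Variable C : numClosedFieldType.

(** The threshold with complex data, so that it can be compared with complex
    entries without casts. *)
Definition hook_threshold (c : nat -> C) (M N : nat) (rho : C) : C :=
  \sum_(j < N) (hook_dim M N j)%:R ^+ 2 * (rho ^+ (M - j) / c j).

(** With [y_k = sum_i v_i^* u_i^k], the claim at [v] is
    [|y_M|^2 <= t sum_k c_k |y_k|^2]. *)
Lemma posform_rank1_pow (N M : nat) (c : nat -> C) (rho t : C) (u : 'I_N -> C) :
  (N <= M.+1)%N -> (forall j, (j < N)%N -> 0 < c j) ->
  (forall i, u i * (u i)^* <= rho) -> hook_threshold c M N rho <= t ->
  posform (fun i j => t * (\sum_(k < N) c k * (u i * (u j)^*) ^+ k)
                      - (u i * (u j)^*) ^+ M).
Proof.
move=> NM c0 u_rho Kt v.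
case: N NM c0 u u_rho Kt v => [|N] NM c0 u u_rho Kt v; first by rewrite /form big_ord0.
pose y k := \sum_i (v i)^* * u i ^+ k.
have formy k : form (fun i j => (u i * (u j)^*) ^+ k) v = `|y k| ^+ 2.
  rewrite -form_rank1; apply: eq_form => i j.
  by rewrite exprMn rmorphXn.
have -> : form (fun i j => t * (\sum_(k < N.+1) c k * (u i * (u j)^*) ^+ k)
                      - (u i * (u j)^*) ^+ M) v
   = t * (\sum_(k < N.+1) c k * `|y k| ^+ 2) - `|y M| ^+ 2.
  rewrite formB formZ form_sum formy; congr (t * _ - _).
  by apply: eq_bigr => k _; rewrite formZ formy.
have rho0 : 0 <= rho by apply: le_trans (u_rho ord0); rewrite mul_conjC_ge0.
have [|//|p [sp pE pb]] := @interpolation_pow _ (sqrtC rho) (codom u) M.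
- apply/allP => x /codomP [i ->].
  by rewrite -(ler_pXn2r (n := 2)) ?nnegrE ?sqrtC_ge0 // sqrtCK normCK.
- by rewrite size_codom card_ord.
rewrite size_codom card_ord in sp pb.
(* the interpolation identity, integrated against [v] *)
have -> : y M = \sum_(k < N.+1) p`_k * y k.
  under eq_bigr => k _ do rewrite mulr_sumr.
  rewrite exchange_big; apply: eq_bigr => i _ /=.
  rewrite -pE ?codom_f // (horner_coef_wide _ sp) mulr_sumr.
  by apply: eq_bigr => k _; rewrite mulrCA.
rewrite subr_ge0.
(* the weights [c k] are split so that the second factor gives the form of
   [sum_k c_k A^(o k)] *)
pose a (k : 'I_N.+1) := `|p`_k| / sqrtC (c k).
pose b (k : 'I_N.+1) := sqrtC (c k) * `|y k|.
have s0 k : (k < N.+1)%N -> 0 < sqrtC (c k) by move=> kN; rewrite sqrtC_gt0 c0.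
apply: (@le_trans _ _ ((\sum_k a k * b k) ^+ 2)).
  rewrite ler_pXn2r ?nnegrE //.
    rewrite (le_trans (ler_norm_sum _ _ _)) //; apply: ler_sum => k _.
    by rewrite normrM /a /b mulrA divfK // gt_eqF ?s0.
  by apply: sumr_ge0 => k _; rewrite /a /b mulrA divfK ?mulr_ge0 // gt_eqF ?s0.
apply: le_trans (cauchy_schwarz_sum _ _) _.
- by move=> k; rewrite /a divr_ge0 // ltW ?s0.
- by move=> k; rewrite /b mulr_ge0 // ltW ?s0.
have -> : \sum_k b k ^+ 2 = \sum_(k < N.+1) c k * `|y k| ^+ 2.
  by apply: eq_bigr => k _; rewrite exprMn sqrtCK.
apply: ler_wpM2r.
  by apply: sumr_ge0 => k _; rewrite mulr_ge0 ?exprn_ge0 // ltW ?c0.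
apply: le_trans Kt; apply: ler_sum => k _.
rewrite exprMn exprVn sqrtCK mulrA ler_wpM2r ?invr_ge0 ?(ltW (c0 _ _)) //.
have -> : rho ^+ (M - k) = (sqrtC rho ^+ (M - k)) ^+ 2 by rewrite exprAC sqrtCK.
rewrite -exprMn.
by rewrite ler_pXn2r ?nnegrE ?mulr_ge0 ?exprn_ge0 ?sqrtC_ge0 // pb.
Qed.

End RankOne.

(** * Lifting from rank one to all matrices *)

Section Lifting.
Variable R : rcfType.
Local Notation C := R[i].

(** To be used for the real and imaginary parts, which are not ring morphisms
    but are linear over the reals. *)
Lemma horner_real_proj (f : C -> R) (p : {poly C}) (x : R) :
  (forall y z, f (y + z) = f y + f z) -> (forall z (a : R), f (z * a%:C) = f z * a) ->
  f p.[x%:C] = (\poly_(i < size p) f p`_i).[x].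
Proof.
move=> fD fZ; have f0 : f 0 = 0 by apply: (addrI (f 0)); rewrite -fD !addr0.
rewrite horner_poly horner_coef (big_morph f fD f0); apply: eq_bigr => i _.
by rewrite -rmorphXn fZ.
Qed.

Lemma deriv_real_proj (f : C -> R) (p : {poly C}) :
  (forall y z, f (y + z) = f y + f z) ->
  (\poly_(i < size p) f p`_i)^`() = \poly_(i < size p^`()) f p^`()`_i.
Proof.
move=> fD; have f0 : f 0 = 0 by apply: (addrI (f 0)); rewrite -fD !addr0.
have fE (q : {poly C}) i : (\poly_(i < size q) f q`_i)`_i = f q`_i.
  by rewrite coef_poly; case: ltnP => // le; rewrite nth_default.
apply/polyP => i; rewrite coef_deriv !fE coef_deriv.
by move: p`_i.+1 => z; elim: i.+1 => // k IHk; rewrite !mulrS fD IHk.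
Qed.

(** Mean value theorem for the real and the imaginary part separately; the
    latter is constant since the derivative is real. *)
Lemma complex_poly_le (p : {poly C}) :
  (forall x : R, 0 <= x <= 1 -> 0 <= p^`().[x%:C]) -> p.[0] <= p.[1].
Proof.
move=> dp.
have ReD (y z : C) : complex.Re (y + z) = complex.Re y + complex.Re z.
  by case: y z => [a b] [a' b'].
have ImD (y z : C) : complex.Im (y + z) = complex.Im y + complex.Im z.
  by case: y z => [a b] [a' b'].
have ReZ (z : C) (a : R) : complex.Re (z * a%:C) = complex.Re z * a.
  by case: z => [? ?] /=; rewrite mulr0 subr0.
have ImZ (z : C) (a : R) : complex.Im (z * a%:C) = complex.Im z * a.
  by case: z => [? ?] /=; rewrite mulr0 add0r.
have mvt (f : C -> R) (fD : forall y z, f (y + z) = f y + f z)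
    (fZ : forall z (a : R), f (z * a%:C) = f z * a) :
  exists2 x : R, 0 <= x <= 1 & f p.[1] - f p.[0] = f p^`().[x%:C].
  have [x x01] := poly_mvt (\poly_(i < size p) f p`_i) (@ltr01 R).
  rewrite -[p.[1]]/(p.[1%:C]) -[p.[0]]/(p.[0%:C]).
  rewrite deriv_real_proj // -!horner_real_proj // subr0 mulr1 => e.
  by exists x => //; rewrite !ltW ?(itvP x01).
rewrite lecE -subr_eq0 -subr_ge0.
have [x x01 ->] := mvt _ ImD ImZ; have [y y01 ->] := mvt _ ReD ReZ.
have := dp x x01; have := dp y y01; rewrite !lecE /=.
by move=> /andP[_ ->] /andP[->].
Qed.

(** Up to the factor [M = m + 1], the derivative of [t sum_k c_k z^k - z^M] is
    of the same shape with exponent [m] and coefficients [(j + 1) c_(j+1) / M].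
    Term by term, the new threshold is the old one times [j' / M <= 1], where
    [j' = j + 1]. *)
Lemma hook_threshold_deriv (c : nat -> C) (m n : nat) (rho : C) :
  (n <= m)%N -> (forall j, (j < n.+1)%N -> 0 < c j) -> 0 <= rho ->
  hook_threshold (fun j => j.+1%:R * c j.+1 / m.+1%:R) m n rho
  <= hook_threshold c m.+1 n.+1 rho.
Proof.
move=> nm c0 rho0; rewrite /hook_threshold big_ord_recl /=.
apply: (@le_trans _ _ (\sum_(i < n) (hook_dim m.+1 n.+1 i.+1)%:R ^+ 2 *
    (rho ^+ (m.+1 - i.+1) / c i.+1))); last first.
  rewrite lerDr mulr_ge0 ?exprn_ge0 ?ler0n // divr_ge0 ?exprn_ge0 //.
  by rewrite ltW ?c0.
apply: ler_sum => i _; have ci : 0 < c i.+1 by rewrite c0 // ltnS.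
have im : (i.+1 <= m.+1)%N by rewrite ltnS (leq_trans (ltnW (ltn_ord i))).
have hookE : (i.+1 * hook_dim m.+1 n.+1 i.+1 = m.+1 * hook_dim m n i)%N.
  by rewrite /hook_dim mulnA mulnA -mul_bin_diag !subSS.
have i0 : i.+1%:R != 0 :> C by rewrite pnatr_eq0.
have -> : (hook_dim m.+1 n.+1 i.+1)%:R = m.+1%:R * (hook_dim m n i)%:R / i.+1%:R :> C.
  by apply: (mulfI i0); rewrite -[LHS]natrM hookE natrM [RHS]mulrC divfK.
have mE : m.+1%:R != 0 :> C by rewrite pnatr_eq0.
have cn : c i.+1 != 0 by rewrite gt_eqF.
rewrite subSS.
have pq : i.+1%:R <= m.+1%:R :> C by rewrite ler_nat.
have p0 : 0 <= i.+1%:R :> C by rewrite ler0n.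
have q0 : 0 <= m.+1%:R :> C by rewrite ler0n.
have h0 : 0 <= (hook_dim m n i)%:R :> C by rewrite ler0n.
have r0 : 0 <= rho ^+ (m - i) by rewrite exprn_ge0.
move: (hook_dim m n i)%:R (rho ^+ (m - i)) (i.+1%:R) (m.+1%:R) (c i.+1)
  pq p0 q0 h0 r0 i0 mE ci cn => h r p q d pq p0 q0 h0 r0 pn qn d0 dn.
have -> : h ^+ 2 * (r / (p * d / q)) = (h ^+ 2 * r / d * q / p ^+ 2) * p.
  by field; rewrite dn pn qn.
have -> : (q * h / p) ^+ 2 * (r / d) = (h ^+ 2 * r / d * q / p ^+ 2) * q.
  by field; rewrite dn pn.
apply: ler_wpM2l => //.
by rewrite !(divr_ge0, mulr_ge0, exprn_ge0) // ltW.
Qed.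

(** The threshold for one monomial, by the lifting argument of FitzGerald and
    Horn.  Only the diagonal has to be bounded, and this bound is inherited by
    the rank one part and by the whole segment from it to [A]. *)
Lemma posform_monomial (N M : nat) (c : nat -> C) (rho t : C) (A : 'I_N -> 'I_N -> C) :
  (N <= M)%N -> (forall j, (j < N)%N -> 0 < c j) ->
  posform A -> (forall i, A i i <= rho) -> hook_threshold c M N rho <= t ->
  posform (fun i j => t * (\sum_(k < N) c k * A i j ^+ k) - A i j ^+ M).
Proof.
elim: N M c A => [|n IHn] M c A NM c0 pA A_rho Kt v; first by rewrite /form big_ord0.
case: M NM Kt => [//|m] nm Kt; rewrite ltnS in nm.
have a0 : 0 <= A ord0 ord0 by apply: posform_diag.
have rho0 : 0 <= rho by apply: le_trans (A_rho ord0).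
pose u i := A i ord0 / sqrtC (A ord0 ord0).
have uE i j : A i ord0 * A ord0 j / A ord0 ord0 = u i * (u j)^*.
  rewrite /u rmorphM fmorphV /= (posform_herm j ord0 pA).
  have -> : (sqrtC (A ord0 ord0))^* = sqrtC (A ord0 ord0).
    by apply/CrealP; rewrite ger0_real ?sqrtC_ge0.
  by rewrite -[in LHS](sqrtCK (A ord0 ord0)) expr2 invfM; ring.
pose S := schur_compl A; have pS : posform S by apply: posform_schur_compl.
have AE i j : A i j = u i * (u j)^* + border S i j.
  by rewrite [LHS](schur_complE i j pA) uE.
have S_lift i j : border S (lift ord0 i) (lift ord0 j) = S i j.
  by rewrite /border !liftK.
have Sii i : 0 <= border S i i.
  by rewrite /border; case: unlift => // k; apply: posform_diag.
pose f : {poly C} := t *: (\sum_(k < n.+1) c k *: 'X^k) - 'X^(m.+1).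
have fE x : f.[x] = t * (\sum_(k < n.+1) c k * x ^+ k) - x ^+ m.+1.
  rewrite /f !hornerE horner_sum; congr (_ * _ - _).
  by apply: eq_bigr => k _; rewrite !hornerE.
pose c' j := j.+1%:R * c j.+1 / m.+1%:R.
have f'E x : f^`().[x] = m.+1%:R * (t * (\sum_(k < n) c' k * x ^+ k) - x ^+ m).
  rewrite /f derivB derivZ raddf_sum derivXn !hornerE hornerMn hornerXn.
  rewrite mulrBr [_ * x ^+ m]mulr_natl; congr (_ - _).
  rewrite horner_sum big_ord_recl /= derivZ derivC scaler0 hornerE add0r.
  rewrite mulrCA; congr (t * _); rewrite mulr_sumr; apply: eq_bigr => k _.
  rewrite derivZ derivXn hornerZ hornerMn hornerXn /c' /=.
  rewrite /bump /= add1n /= -mulr_natl; set r := m.+1%:R.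
  have r0 : r != 0 by rewrite pnatr_eq0.
  by rewrite [RHS]mulrA [r * _]mulrC divfK // mulrCA mulrA.
clearbody f.
(* the form at [v] of [f[z z^* + x B]], as a polynomial in [x] *)
pose phi : {poly C} := \sum_i \sum_j ((v i)^* * v j) *:
  (f \Po ((u i * (u j)^*)%:P + border S i j *: 'X)).
have phiE x : phi.[x] = form (fun i j => f.[u i * (u j)^* + border S i j * x]) v.
  rewrite /phi horner_sum; apply: eq_bigr => i _; rewrite horner_sum.
  by apply: eq_bigr => j _; rewrite hornerZ horner_comp !hornerE.
have -> : form (fun i j => t * (\sum_(k < n.+1) c k * A i j ^+ k) - A i j ^+ m.+1) v
  = phi.[1].
  by rewrite phiE; apply: eq_form => i j; rewrite fE mulr1 -AE.
apply: le_trans (_ : phi.[0] <= _).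
  rewrite phiE; have := @posform_rank1_pow C n.+1 m.+1 c rho t u.
  move=> /(_ (leqW nm) c0 _ Kt v); rewrite /form.
  under [X in _ -> _ <= X]eq_bigr => i _ do under eq_bigr => j _ do rewrite mulr0 addr0 fE.
  by apply=> i; apply: le_trans (A_rho i); rewrite AE lerDl.
apply: complex_poly_le => x /andP[x0 x1].
have x0' : 0 <= x%:C :> C by rewrite lecR.
have x1' : x%:C <= 1 :> C by rewrite (lecR x 1).
pose Y i j := u (lift ord0 i) * (u (lift ord0 j))^* + x%:C * S i j.
have pY : posform Y.
  apply: posformD; last exact: posformZ.
  exact: posform_rank1 (fun i => u (lift ord0 i)).
(* induction hypothesis for [f'], then the Schur product with [B] *)
have pf : posform (fun i j => S i j * f^`().[Y i j]).
  apply: posformM => //.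
  apply: eq_posform (posformZ (ler0n C m.+1) (IHn m c' Y nm _ pY _ _)) => [i j|j jn|i|].
  - by rewrite f'E.
  - by rewrite /c' divr_gt0 ?mulr_gt0 ?ltr0n ?c0.
  - apply: le_trans (A_rho (lift ord0 i)); rewrite AE S_lift lerD2l.
    by rewrite ler_piMl // posform_diag.
  - exact: le_trans (hook_threshold_deriv nm c0 rho0) Kt.
have := pf (fun i => v (lift ord0 i)); congr (_ <= _).
transitivity (\sum_i \sum_j
  (v i)^* * v j * f^`().[u i * (u j)^* + border S i j * x%:C] * border S i j).
  rewrite sum_border; apply: eq_bigr => i _; apply: eq_bigr => j _.
  by rewrite S_lift /Y [S i j * x%:C]mulrC; ring.
rewrite /phi raddf_sum horner_sum; apply: eq_bigr => i _.
rewrite raddf_sum horner_sum; apply: eq_bigr => j _.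
rewrite /= derivZ deriv_comp derivD derivC derivZ derivX add0r.
by rewrite hornerZ hornerM horner_comp !hornerE /= mulr1.
Qed.

End Lifting.

(** * Power series as limits of truncations *)

Lemma cvg_horner (K : numFieldType) (p : {poly K}) (u : nat -> K^o) (l : K^o) :
  u @ \oo --> l -> (fun n => p.[u n] : K^o) @ \oo --> (p.[l] : K^o).
Proof.
move=> ul; elim/poly_ind: p => [|p a IHp].
  rewrite horner0; under eq_cvg do rewrite horner0; exact: cvg_cst.
rewrite !hornerE; under eq_cvg do rewrite !hornerE.
apply: cvgD; last exact: cvg_cst.
exact: (@cvgM K _ _ _ (fun n => p.[u n]) u).
Qed.

Section Limits.
Variable R : realType.
Local Notation C := R[i].

(** The positive cone of the complex numbers is closed because it is the set of
    fixed points of the norm. *)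
Lemma cvg_complex_ge0 (u : nat -> C^o) (l : C^o) :
  (forall n, 0 <= (u n : C)) -> u @ \oo --> l -> 0 <= (l : C).
Proof.
move=> u0 /cvgrPdist_lt ul.
suff : `|l : C| - l == 0 by rewrite subr_eq0 => /eqP <-.
rewrite -normr_le0; apply/ler_addgt0Pr => e e0; rewrite add0r.
have e20 : 0 < e / 2 by rewrite divr_gt0.
have [n _ /(_ n (leqnn n))] := ul _ e20 => un.
rewrite (le_trans (ler_distD (u n : C) _ _)) // [leRHS]splitr lerD //; last first.
  by rewrite distrC ltW.
rewrite -[X in _ - X](ger0_norm (u0 n)).
by rewrite (le_trans (ler_dist_dist _ _)) // ltW.
Qed.

Lemma posform_lim N (F : nat -> 'I_N -> 'I_N -> C) (L : 'I_N -> 'I_N -> C) :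
  (forall n, posform (F n)) ->
  (forall i j, (fun n => F n i j : C^o) @ \oo --> (L i j : C^o)) -> posform L.
Proof.
move=> pF FL v; apply: (@cvg_complex_ge0 (fun n => form (F n) v)) => [n|]; first exact: pF.
rewrite /form; apply: cvg_big => [|i _]; first exact: add_continuous.
apply: cvg_big => [|j _]; first exact: add_continuous.
exact: (@cvgZl_tmp _ C^o _ _ _ ((v i)^* * v j) (fun n => F n i j) (L i j) (FL i j)).
Qed.

Local Open Scope sesquilinear_scope.

Lemma form_mx N (A : 'M[C]_N) (v : 'cV[C]_N) :
  (v^t* *m A *m v) ord0 ord0 = form A (fun i => v i ord0).
Proof.
rewrite /form mxE exchange_big; apply: eq_bigr => j _.
rewrite mxE mulr_suml; apply: eq_bigr => i _.
by rewrite !mxE mulrAC.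
Qed.

Lemma psdmx_posform N (A : 'M[C]_N) : psdmx A <-> posform A.
Proof.
split=> [[_ pA] v|pA].
  have := pA (\col_i v i); rewrite form_mx; congr (_ <= _).
  by apply: eq_form => i j; rewrite !mxE.
split=> [|v]; last by rewrite form_mx.
apply/is_hermitianmxP/matrixP => i j.
by rewrite expr0 scale1r !mxE; apply: posform_herm.
Qed.

Lemma hook_threshold_real (c : nat -> R) M N (rho : R) :
  hook_threshold (fun j => (c j)%:C) M N rho%:C = (threshold c M N rho)%:C.
Proof.
rewrite /hook_threshold /threshold rmorph_sum; apply: eq_bigr => j _.
rewrite /hook_dim natrM exprMn !rmorphM /= fmorphV rmorphXn /=.
by rewrite !rmorph_nat -!expr2 -!natrX.
Qed.

Lemma threshold_ge0 (c : nat -> R) M N (rho : R) : 0 <= rho ->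
  (forall j : nat, (j < N)%N -> 0 < c j) -> 0 <= threshold c M N rho.
Proof.
move=> rho0 hc; apply: sumr_ge0 => j _.
by rewrite !mulr_ge0 ?ler0n ?exprn_ge0 // invr_ge0 ltW ?hc.
Qed.

(** A monomial with a nonpositive coefficient contributes a positive form by
    itself; one with a positive coefficient uses up its own threshold. *)
Lemma posform_truncation (rho : R) (N n : nat) (c : nat -> R) (t : R)
    (A : 'I_N -> 'I_N -> C) :
  (forall j : nat, (j < N)%N -> 0 < c j) -> posform A -> (forall i, A i i <= rho%:C) ->
  \sum_(N <= M < n | 0 < c M) c M * threshold c M N rho <= t ->
  posform (fun i j => t%:C * (\sum_(k < N) (c k)%:C * A i j ^+ k)
                      - \sum_(N <= M < n) (c M)%:C * A i j ^+ M).
Proof.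
move=> hc pA Arho; set T := \sum_(N <= M < n | _) _ => Tt.
pose P i j := \sum_(k < N) (c k)%:C * A i j ^+ k.
have cC k : (k < N)%N -> 0 < (c k)%:C by move=> kN; rewrite (ltcR 0) hc.
have pP : posform P.
  by apply: posform_sum => k _; apply: posformZ (posformX _ pA); rewrite ltW ?cC.
pose G M i j := if 0 < c M then
    (c M)%:C * ((threshold c M N rho)%:C * P i j - A i j ^+ M)
  else (- c M)%:C * A i j ^+ M.
have pG M : (N <= M)%N -> posform (G M).
  move=> NM; rewrite /G; case: ltP => cM; last first.
    by apply: posformZ (posformX _ pA); rewrite (lecR 0) oppr_ge0.
  apply: posformZ; first by rewrite (lecR 0) ltW.
  apply: (@posform_monomial R N M (fun j => (c j)%:C) rho%:C) => //.
  by rewrite hook_threshold_real.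
have pT : posform (fun i j => (t - T)%:C * P i j).
  by apply: posformZ pP; rewrite (lecR 0) subr_ge0.
apply: eq_posform (posformD pT (posform_sum (index_iota N n) pG)) => i j.
have -> : \sum_(M <- index_iota N n | (N <= M)%N) G M i j =
    T%:C * P i j - \sum_(N <= M < n) (c M)%:C * A i j ^+ M.
  rewrite /T [in RHS]big_mkcond rmorph_sum /= mulr_suml -sumrB big_nat_cond [RHS]big_nat_cond.
  apply: eq_big => [M|M /andP[_ _]]; first by rewrite andbT andbAC andbb.
  rewrite /G; case: ifP => _; first by rewrite rmorphM /=; ring.
  by rewrite mul0r sub0r rmorphN /= mulNr.
by rewrite rmorphB /= -/(P i j); ring.
Qed.

Lemma normc_real (x : R) : `|x%:C| = `|x|%:C :> C.
Proof. by rewrite normc_def /= expr0n addr0 sqrtr_sqr. Qed.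

Lemma cvg_realC (u : nat -> R) (l : R) :
  u @ \oo --> l -> (fun n => (u n)%:C : C^o) @ \oo --> (l%:C : C^o).
Proof.
move=> /cvgrPdist_lt ul; apply/cvgrPdist_lt => e e0.
have eE : (complex.Re e)%:C = e by rewrite RRe_real // gtr0_real.
have /ul : 0 < complex.Re e by rewrite -ltcR eE.
by apply: filterS => n un; rewrite -rmorphB /= normc_real -eE ltcR.
Qed.

(** Two successive limits of [posform_truncation]: in the length of the
    truncation at a contracted matrix, then in the contraction factor. *)
Lemma posform_series (rho : R) (N : nat) (c : nat -> R) (g : C^o -> C^o) (t : R)
    (A : 'I_N -> 'I_N -> C) :
  0 < rho -> (forall j : nat, (j < N)%N -> 0 < c j) ->
  analytic_series c N rho g -> {within closed_disc rho, continuous g} ->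
  (forall n, \sum_(N <= M < n | 0 < c M) c M * threshold c M N rho <= t) ->
  posform A -> (forall i j, closed_disc rho (A i j)) ->
  posform (fun i j => t%:C * (\sum_(k < N) (c k)%:C * A i j ^+ k) - g (A i j)).
Proof.
move=> rho0 hc hg /subspace_continuousP hgc Tt pA Arho.
have Anorm i j : `|A i j : C| <= rho%:C := Arho i j.
pose p : {poly C} := t%:C *: (\sum_(k < N) (c k)%:C *: 'X^k).
have pE x : p.[x] = t%:C * (\sum_(k < N) (c k)%:C * x ^+ k).
  rewrite /p hornerZ horner_sum; congr (_ * _).
  by apply: eq_bigr => k _; rewrite hornerZ hornerXn.
(* entries of [A] may lie on the boundary circle, where the series need not
   converge: approach them radially *)
pose s m : R := 1 - harmonic m.
have s0 m : 0 <= s m by rewrite subr_ge0 invf_le1 ?ler1n.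
have s1 m : s m < 1 by rewrite ltrBlDr ltrDl harmonic_gt0.
have sA i j : (fun m => (s m)%:C * A i j : C^o) @ \oo --> (A i j : C^o).
  rewrite -[X in _ --> X]mul1r.
  apply: (@cvgZr_tmp _ C^o _ _ _ (fun m => (s m)%:C) (1 : C) (A i j)).
  apply: (@cvg_realC s 1); rewrite -[X in _ --> X]subr0.
  by apply: cvgB; [exact: cvg_cst | exact: cvg_harmonic].
apply: (@posform_lim N (fun m i j => p.[(s m)%:C * A i j] - g ((s m)%:C * A i j))); last first.
  move=> i j; rewrite -pE; apply: cvgB; first exact: cvg_horner (sA i j).
  apply: cvg_comp (hgc _ (Arho i j)).
  move=> U /= /sA[n _ nU]; exists n => // m nm; apply: (nU m nm).
  rewrite /closed_disc /= normrM normc_real (ger0_norm (s0 m)) //.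
  by apply: le_trans (Anorm i j); rewrite ler_piMl // (lecR _ 1) ltW.
move=> m.
apply: (@posform_lim N (fun n i j => p.[(s m)%:C * A i j] -
  \sum_(N <= M < n) (c M)%:C * ((s m)%:C * A i j) ^+ M)); last first.
  move=> i j; apply: cvgB; first exact: cvg_cst.
  apply: hg; rewrite /open_disc /= normrM normc_real (ger0_norm (s0 m)) //.
  have [->|A0] := eqVneq (A i j) 0; first by rewrite normr0 mulr0 (ltcR 0).
  apply: lt_le_trans (Anorm i j); rewrite gtr_pMl ?normr_gt0 //.
  by rewrite (ltcR _ 1).
move=> n; have sC0 : 0 <= (s m)%:C :> C by rewrite (lecR 0).
have diag i : (s m)%:C * A i i <= rho%:C.
  apply: le_trans (Anorm i i); rewrite (ger0_norm (posform_diag i pA)).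
  by rewrite ler_piMl ?posform_diag // (lecR _ 1) ltW.
have := @posform_truncation rho N n c t (fun i j => (s m)%:C * A i j)
  hc (posformZ sC0 pA) diag (Tt n).
by apply: eq_posform => i j; rewrite pE.
Qed.

End Limits.

(** * Derivatives of power series on the real axis *)

Section PowerSeries.
Variable R : realType.
Implicit Types (e : nat -> R) (r x y : R).

(** If [h] is bounded the limit is its supremum, otherwise [h] eventually exceeds
    every bound. *)
Lemma cvg_left_nondecreasing (h : R -> R) (a r : R) : a < r ->
  {in `]a, r[ &, {homo h : x y / x <= y}} ->
  cvg ((h x)%:E @[x --> r^'-]).
Proof.
move=> ar hnd.
have ge_near x : x \in `]a, r[ -> \forall y \near r^'-, h x <= h y.
  move=> xar; have xr := xar; rewrite in_itv /= in xr; near=> y.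
  have xy : x < y by near: y; apply: nbhs_left_gt; case/andP: xr.
  have yr : y < r by near: y; exact: nbhs_left_lt.
  by apply: hnd => //; rewrite ?in_itv /= ?yr ?andbT ?ltW // (lt_trans _ xy) //; case/andP: xr.
have [[B hB]|unb] := pselect (exists B, forall x, x \in `]a, r[ -> h x <= B).
  have /cvg_ex[l hl] : cvg (h x @[x --> r^'-]).
    apply: nondecreasing_at_left_is_cvgr; near=> b.
      have ab : a < b by near: b; apply: nbhs_left_gt.
      move=> x y xb yb; apply: hnd.
        by move: xb; rewrite !in_itv /= => /andP[bx ->]; rewrite (lt_trans ab).
      by move: yb; rewrite !in_itv /= => /andP[bx ->]; rewrite (lt_trans ab).
    have ab : a < b by near: b; apply: nbhs_left_gt.
    exists B => _ [y yb <-]; apply: hB.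
    by move: yb; rewrite /= !in_itv /= => /andP[bx ->]; rewrite (lt_trans ab).
  by apply: (cvgP l%:E); apply: cvg_EFin hl; near=> x.
apply: (cvgP +oo%E); apply/cvgeyPge => B.
have [x xar hx] : exists2 x, x \in `]a, r[ & B < h x.
  apply: contrapT => no; apply: unb; exists B => x xar.
  by rewrite leNgt; apply/negP => hx; apply: no; exists x.
by apply: filterS (ge_near x xar) => y xy; rewrite lee_fin (le_trans (ltW hx)).
Unshelve. all: by end_near. Qed.

(** The radius of convergence is at least [r].  Stated by boundedness of the
    terms rather than convergence, as this is what differentiation preserves
    most directly. *)
Definition radius_ge e r : Prop :=
  forall x, 0 < x -> x < r -> exists B, forall m, `|e m| * x ^+ m <= B.

(** The first [m + 1] terms of the geometric series are at least [q^m]. *)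
Lemma natr_geometric_le (q : R) m : 0 <= q -> q < 1 -> m.+1%:R * q ^+ m <= (1 - q)^-1.
Proof.
move=> q0 q1; have q1' : 0 < 1 - q by rewrite subr_gt0.
rewrite -[leRHS]mul1r ler_pdivlMr //.
apply: (@le_trans _ _ ((\sum_(i < m.+1) q ^+ i) * (1 - q))).
  rewrite ler_wpM2r ?(ltW q1') // mulr_natl.
  have -> : q ^+ m *+ m.+1 = \sum_(i < m.+1) q ^+ m by rewrite sumr_const card_ord.
  by apply: ler_sum => i _; apply: ler_wiXn2l; rewrite ?(ltW q1) // -ltnS.
by rewrite mulrC -opprB mulNr -subrX1 opprB gerBl exprn_ge0.
Qed.

Lemma radius_ge_cvg e r x : radius_ge e r -> `|x| < r -> cvgn (pseries e x).
Proof.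
move=> er xr; pose y := (`|x| + r) / 2.
have xy : `|x| < y by rewrite /y; lra.
have yr : y < r by rewrite /y; lra.
have y0 : 0 < y := le_lt_trans (normr_ge0 x) xy.
have [B eB] := er y y0 yr.
have B0 : 0 <= B by apply: le_trans (eB 0%N); rewrite mulr_ge0 // exprn_ge0 // ltW.
have q0 : 0 <= `|x| / y by rewrite divr_ge0 // ltW.
apply: normed_cvg; apply: (@series_le_cvg _ _ (geometric B (`|x| / y))).
- by move=> n /=.
- by move=> n /=; rewrite mulr_ge0 ?exprn_ge0.
- move=> n /=; rewrite normrM normrX.
  have -> : `|x| ^+ n = y ^+ n * (`|x| / y) ^+ n.
    by rewrite -exprMn mulrCA mulfV ?mulr1 ?gt_eqF.
  by rewrite mulrA ler_wpM2r ?exprn_ge0.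
by apply: is_cvg_geometric_series; rewrite ger0_norm // ltr_pdivrMr ?mul1r.
Qed.

Lemma radius_ge_diffs e r : radius_ge e r -> radius_ge (pseries_diffs e) r.
Proof.
move=> er x x0 xr; pose y := (x + r) / 2.
have xy : x < y by rewrite /y; lra.
have yr : y < r by rewrite /y; lra.
have y0 : 0 < y := lt_trans x0 xy.
have [B eB] := er y y0 yr.
have q0 : 0 <= x / y by rewrite divr_ge0 // ltW.
have q1 : x / y < 1 by rewrite ltr_pdivrMr ?mul1r.
exists (B / y * (1 - x / y)^-1) => m.
rewrite /pseries_diffs normrM ger0_norm ?ler0n //.
have -> : m.+1%:R * `|e m.+1| * x ^+ m =
  (`|e m.+1| * y ^+ m.+1 / y) * (m.+1%:R * (x / y) ^+ m).
  have yn : y != 0 by rewrite gt_eqF.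
  have -> : x ^+ m = y ^+ m * (x / y) ^+ m by rewrite -exprMn mulrCA mulfV ?mulr1.
  have -> : `|e m.+1| * y ^+ m.+1 / y = `|e m.+1| * y ^+ m.
    by rewrite exprSr mulrA mulfK.
  by ring.
rewrite ler_pM //.
- by apply: divr_ge0; [rewrite mulr_ge0 ?exprn_ge0 ?(ltW y0) | exact: ltW].
- by rewrite mulr_ge0 ?exprn_ge0.
- by rewrite ler_wpM2r ?invr_ge0 ?(ltW y0).
exact: natr_geometric_le.
Qed.

Lemma radius_ge_diffsn e r k : radius_ge e r -> radius_ge (iter k (@pseries_diffs R) e) r.
Proof. by move=> er; elim: k => //= k IHk; apply: radius_ge_diffs. Qed.

(** Differentiation is local, so that the induction only needs the values of the
    derivatives inside the disc. *)
Lemma derive1n_pseries (f : R -> R) e r k x : radius_ge e r ->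
  (forall x, `|x| < r -> f x = limn (pseries e x)) ->
  `|x| < r -> derive1n k f x = limn (pseries (iter k (@pseries_diffs R) e) x).
Proof.
move=> er fE; elim: k x => [|k IHk] x xr; first by rewrite derive1n0 fE.
rewrite derive1nS derive1E /=.
set E := iter k _ e.
have Er : radius_ge E r by apply: radius_ge_diffsn.
pose y := (`|x| + r) / 2.
have xy : `|x| < y by rewrite /y; lra.
have yr : y < r by rewrite /y; lra.
have y0 : 0 < y := le_lt_trans (normr_ge0 x) xy.
have yE : `|y| = y by rewrite gtr0_norm.
have -> : 'D_1 (derive1n k f) x = 'D_1 (fun x => limn (pseries E x)) x.
  apply: near_eq_derive; near=> z; apply: IHk.
  have : `|x - z| < r - `|x|.
    by near: z; apply: cvgr_dist_lt => //; rewrite subr_gt0.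
  by rewrite ltrBrDl; apply: le_lt_trans; rewrite -{1}[z](subKr x) ler_normB.
have cvgy a : radius_ge a r -> cvgn (pseries a y).
  by move=> ar; apply: radius_ge_cvg ar _; rewrite yE.
have xy' : `|x| < `|y| by rewrite yE.
have dE := @pseries_snd_diffs R E y x (cvgy _ Er) (cvgy _ (radius_ge_diffs Er))
  (cvgy _ (radius_ge_diffs (radius_ge_diffs Er))) xy'.
exact: derive_val.
Unshelve. all: by end_near. Qed.

Lemma iter_pseries_diffs e k m :
  iter k (@pseries_diffs R) e m = ((m + k) ^_ k)%:R * e (m + k)%N.
Proof.
elim: k m => [|k IHk] m /=; first by rewrite addn0 mul1r.
by rewrite /pseries_diffs IHk mulrA -natrM addnS -addSn ffactnSr mulnC addnK.
Qed.

End PowerSeries.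

(** * Bounding the series of thresholds *)

(** The factors pair up: with [a = M - i], [2a (2a - 1) >= 2 a^2]. *)
Lemma leq_ffact_double M n : (2 ^ n * (M ^_ n) ^ 2 <= (2 * M) ^_ (2 * n))%N.
Proof.
elim: n => [|n IHn]; first by rewrite !muln0.
rewrite (_ : 2 * n.+1 = (2 * n).+2)%N; last by lia.
rewrite (ffactnSr M n) (ffactnSr _ (2 * n).+1) (ffactnSr _ (2 * n)) (expnS 2 n) expnMn.
have -> : (2 * 2 ^ n * ((M ^_ n) ^ 2 * (M - n) ^ 2) =
  2 ^ n * (M ^_ n) ^ 2 * (2 * (M - n) ^ 2))%N by lia.
rewrite -[in X in (_ <= X)%N]mulnA; apply: leq_mul => //; rewrite subnS -mulnBr.
by case: (M - n)%N => // a; rewrite expnS expn1; nia.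
Qed.

(** After bounding [M - j - 1] by [M - j], both sides count the flags of subsets
    of sizes [j] and [n] of a set with [M] elements. *)
Lemma leq_hook_dim M n j : (j <= n)%N -> (n <= M)%N ->
  (hook_dim M n.+1 j <= 'C(M, n) * 'C(n, j))%N.
Proof.
move=> jn nM; rewrite /hook_dim.
apply: (@leq_trans ('C(M, j) * 'C(M - j, n - j))).
  have -> : (n.+1 - j - 1 = n - j)%N by lia.
  by rewrite leq_mul2l leq_bin2l ?orbT // leq_subr.
have jM := leq_trans jn nM.
have f0 : (0 < j`! * (n - j)`! * (M - n)`!)%N by rewrite !muln_gt0 !fact_gt0.
rewrite -(leq_pmul2r f0) leq_eqVlt; apply/orP; left; apply/eqP.
transitivity (M`!).
  rewrite -(bin_fact jM) -(@bin_fact (M - j) (n - j)) ?leq_sub2r //.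
  by rewrite (_ : M - j - (n - j) = M - n)%N; lia.
by rewrite -(bin_fact nM) -(bin_fact jn); lia.
Qed.

Lemma hook_dim_bound M n j : (j <= n)%N -> (n <= M)%N ->
  (hook_dim M n.+1 j ^ 2 * (2 ^ n * n`! ^ 2) <= (2 * M) ^_ (2 * n) * 'C(n, j) ^ 2)%N.
Proof.
move=> jn nM.
apply: (@leq_trans ('C(M, n) ^ 2 * 'C(n, j) ^ 2 * (2 ^ n * n`! ^ 2))).
  by rewrite leq_mul2r -expnMn leq_sqr leq_hook_dim ?orbT.
have -> : ('C(M, n) ^ 2 * 'C(n, j) ^ 2 * (2 ^ n * n`! ^ 2) =
  2 ^ n * ('C(M, n) * n`!) ^ 2 * 'C(n, j) ^ 2)%N by rewrite expnMn; lia.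
by rewrite bin_ffact leq_mul2r leq_ffact_double orbT.
Qed.

Section DerivativeBound.
Variable R : realType.
Local Notation C := R[i].
Variables (rho : R) (N : nat) (c : nat -> R) (g : C^o -> C^o).
Hypotheses (rho0 : 0 < rho) (hc : forall j : nat, (j < N)%N -> 0 < c j).
Hypothesis hg : analytic_series c N rho g.

Definition deriv_const : R := (2 ^+ (N - 1) * ((N - 1)`!)%:R ^+ 2)^-1
    * \sum_(j < N) ('C(N - 1, j) ^ 2)%:R * (rho ^+ (N - j - 1) / c j).

(** The factor in front of the constant is the value at [sqrt rho] of the
    derivative of order [2 N - 2] of [x^(2M)].  The comparison holds for each
    index [j], where it is [hook_dim_bound]. *)
Lemma threshold_bound M : (1 <= N)%N -> (N <= M)%N ->
  threshold c M N rho <= ((2 * M) ^_ (2 * N - 2))%:R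
     * Num.sqrt rho ^+ (2 * M - (2 * N - 2)) * deriv_const.
Proof.
rewrite /threshold /deriv_const => hN; case: N hN hc => // n _ hcn nM.
rewrite (_ : 2 * n.+1 - 2 = 2 * n)%N; last by lia.
rewrite (_ : 2 * M - 2 * n = 2 * (M - n))%N; last by lia.
rewrite exprM sqr_sqrtr ?(ltW rho0) // subn1 /=.
set a : R := 2 ^+ n * (n`!)%:R ^+ 2.
have a0 : 0 < a by rewrite mulr_gt0 ?exprn_gt0 ?ltr0n ?fact_gt0.
rewrite mulrA mulr_sumr; apply: ler_sum => j _.
have jn : (j <= n)%N by rewrite -ltnS.
have rhoE : rho ^+ (M - j) = rho ^+ (M - n) * rho ^+ (n.+1 - j - 1).
  by rewrite -exprD; congr (_ ^+ _); lia.
rewrite rhoE.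
have h := @hook_dim_bound M n j jn (ltnW nM).
have {}h : ('C(M, j) ^ 2)%:R * ('C(M - j - 1, n.+1 - j - 1) ^ 2)%:R * a
  <= ((2 * M) ^_ (2 * n))%:R * ('C(n, j) ^ 2)%:R :> R.
  have -> : a = (2 ^ n * n`! ^ 2)%:R by rewrite natrM !natrX.
  by rewrite -!natrM ler_nat -expnMn.
have cj : 0 < c j by apply: hcn.
rewrite -(ler_pM2r a0).
have -> : ((2 * M) ^_ (2 * n))%:R * rho ^+ (M - n) / a *
   (('C(n, j) ^ 2)%:R * (rho ^+ (n.+1 - j - 1) / c j)) * a =
  (((2 * M) ^_ (2 * n))%:R * ('C(n, j) ^ 2)%:R) *
   (rho ^+ (M - n) * rho ^+ (n.+1 - j - 1) / c j).
  rewrite mulrAC -[_ * a]mulrA [_ * a]mulrC; field.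
  by rewrite !gt_eqF.
rewrite mulrAC; apply: ler_wpM2r h.
by rewrite divr_ge0 ?mulr_ge0 ?exprn_ge0 ?ltW.
Qed.

Lemma deriv_const_ge0 : 0 <= deriv_const.
Proof.
apply: mulr_ge0; first by rewrite invr_ge0 mulr_ge0 ?exprn_ge0 ?ler0n.
apply: sumr_ge0 => j _; rewrite mulr_ge0 ?ler0n // divr_ge0 ?exprn_ge0 ?ltW //.
by rewrite hc.
Qed.

Definition gplus_coef M : R := if (N <= M)%N && (0 < c M) then c M else 0.
Definition g2_coef m : R := if odd m then 0 else gplus_coef m./2.

Lemma gplus_coef_ge0 M : 0 <= gplus_coef M.
Proof. by rewrite /gplus_coef; case: ifP => // /andP[_ /ltW]. Qed.

Lemma g2_coef_ge0 m : 0 <= g2_coef m.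
Proof. by rewrite /g2_coef; case: ifP => // _; apply: gplus_coef_ge0. Qed.

(** Odd exponents drop out, and the even ones carry the coefficients of [g_+]. *)
Lemma sum_g2_coef (F : nat -> R) n :
  \sum_(0 <= m < 2 * n) g2_coef m * F m =
  \sum_(N <= M < n | 0 < c M) c M * F (2 * M)%N.
Proof.
transitivity (\sum_(0 <= M < n) gplus_coef M * F (2 * M)%N).
  elim: n => [|n IHn]; first by rewrite muln0 !big_geq.
  rewrite (_ : 2 * n.+1 = (2 * n).+2)%N; last by lia.
  rewrite !big_nat_recr //= IHn [g2_coef (2 * n).+1]/g2_coef /= mul2n odd_double /= mul0r addr0.
  by rewrite /g2_coef odd_double doubleK.
rewrite [RHS]big_mkcond [RHS](big_nat_widenl _ 0%N) //= big_mkcond /=.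
rewrite [RHS]big_mkcond; apply: eq_bigr => M _; rewrite /gplus_coef.
by case: leqP => _ /=; rewrite ?mul0r //; case: ifP; rewrite ?mul0r.
Qed.

(** The partial sums of the series of [g] at a positive point of the disc
    converge, hence are bounded, hence so are their consecutive differences. *)
Lemma radius_gplus x : 0 < x -> x < rho -> exists B, forall M, `|gplus_coef M| * x ^+ M <= B.
Proof.
move=> x0 xr; have /hg/cvgP/cvg_seq_bounded[B [Breal hB]] : open_disc rho (x%:C : C^o).
  by rewrite /open_disc /= normc_real ltcR gtr0_norm.
pose K : C := B + 1.
have {}hB n : `|\sum_(N <= M < n) (c M)%:C * x%:C ^+ M : C| <= K.
  by apply: (hB (B + 1)) => //; rewrite ltrDl.
exists (complex.Re (K + K)) => M.
rewrite -lecR RRe_real; last first.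
  by apply: ger0_real; apply: le_trans (lerD (hB 0%N) (hB 0%N)); rewrite addr_ge0.
rewrite ger0_norm ?gplus_coef_ge0 // /gplus_coef.
case: ifP => [/andP[NM cM]|_]; last first.
  by rewrite mul0r; apply: le_trans (lerD (hB 0%N) (hB 0%N)); rewrite addr_ge0.
have -> : (c M * x ^+ M)%:C = `|(c M)%:C * x%:C ^+ M : C|.
  by rewrite -rmorphXn -rmorphM normc_real ger0_norm // mulr_ge0 ?exprn_ge0 ?ltW.
have -> : (c M)%:C * x%:C ^+ M =
    \sum_(N <= m < M.+1) (c m)%:C * x%:C ^+ m - \sum_(N <= m < M) (c m)%:C * x%:C ^+ m.
  by rewrite big_nat_recr //= addrAC subrr add0r.
by rewrite (le_trans (ler_normB _ _)) // lerD.
Qed.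

Lemma radius_g2 : radius_ge g2_coef (Num.sqrt rho).
Proof.
move=> x x0 xr; have x2 : x ^+ 2 < rho.
  by rewrite -[ltRHS]sqr_sqrtr ?(ltW rho0) // ltrXn2r // ?ltW.
have [B hB] := radius_gplus (exprn_gt0 2 x0) x2.
exists B => m; rewrite /g2_coef; case: ifP => [_|om].
  by rewrite normr0 mul0r; apply: le_trans (hB 0%N); rewrite mulr_ge0 // !exprn_ge0 // ltW.
rewrite -{2}(odd_double_half m) om add0n -mul2n exprM; exact: hB.
Qed.

Lemma g2E x : `|x| < Num.sqrt rho -> g2 c N x = limn (pseries g2_coef x).
Proof.
move=> xr; have cv := radius_ge_cvg radius_g2 xr.
rewrite /g2 /gplus; apply/cvg_lim => //.
have -> : (fun n => \sum_(N <= M < n | 0 < c M) c M * (x ^+ 2) ^+ M) =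
   (pseries g2_coef x) \o (fun n => (2 * n)%N).
  apply/funext => n /=; rewrite /pseries /series /= (sum_g2_coef (fun m => x ^+ m)).
  by apply: eq_bigr => M _; rewrite exprM.
apply: cvg_comp cv; apply/cvgnyPge => A; exists A => // n /= An.
by rewrite (leq_trans An) // leq_pmull.
Qed.

Local Notation r := (Num.sqrt rho).
Local Notation E k := (iter k (@pseries_diffs R) g2_coef).

Lemma iter_diffs_ge0 k m : 0 <= E k m.
Proof. by rewrite iter_pseries_diffs mulr_ge0 ?ler0n ?g2_coef_ge0. Qed.

Lemma cvg_g2_derivn k x : `|x| < r -> cvgn (pseries (E k) x).
Proof. by apply: radius_ge_cvg; apply: radius_ge_diffsn; apply: radius_g2. Qed.

Lemma g2_derivnE k x : `|x| < r -> derive1n k (g2 c N) x = limn (pseries (E k) x).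
Proof. exact: (derive1n_pseries k radius_g2 g2E). Qed.

Lemma pseries_le_g2_derivn k x n : 0 <= x -> x < r ->
  pseries (E k) x n <= derive1n k (g2 c N) x.
Proof.
move=> x0 xr; have xr' : `|x| < r by rewrite ger0_norm.
rewrite g2_derivnE //; apply: nondecreasing_cvgn_le; last exact: cvg_g2_derivn.
apply: nondecreasing_series => m _ _ /=.
by rewrite mulr_ge0 ?iter_diffs_ge0 ?exprn_ge0.
Qed.

Lemma cvg_g2_deriv k : cvg (g2_deriv c N k x @[x --> r^'-]).
Proof.
apply: (@cvg_left_nondecreasing R (derive1n k (g2 c N)) 0); first by rewrite sqrtr_gt0.
move=> x y; rewrite !in_itv /= => /andP[x0 xr] /andP[y0 yr] xy.
have xr' : `|x| < r by rewrite gtr0_norm.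
rewrite g2_derivnE //; apply: limr_le; first exact: cvg_g2_derivn.
apply: nearW => n; apply: le_trans (pseries_le_g2_derivn k n (ltW y0) yr).
apply: ler_sum => m _ /=; rewrite ler_wpM2l ?iter_diffs_ge0 //.
by rewrite lerXn2r ?nnegrE ?(ltW x0) ?(ltW y0).
Qed.

(** Partial sums of the [k]th derivative of [g_2], indexed by the exponent in
    [g_+] rather than by the exponent after differentiation; for [2 M < k] the
    falling factorial cancels the truncated exponent. *)
Definition g2_partial k n x : R :=
  \sum_(N <= M < n | 0 < c M) c M * (((2 * M) ^_ k)%:R * x ^+ (2 * M - k)).

Lemma g2_partial_le k n x : 0 <= x -> x < r -> g2_partial k n x <= derive1n k (g2 c N) x.
Proof.
move=> x0 xr; apply: le_trans (pseries_le_g2_derivn k (2 * n) x0 xr).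
rewrite /g2_partial -(sum_g2_coef (fun m => (m ^_ k)%:R * x ^+ (m - k))).
pose T m := g2_coef m * ((m ^_ k)%:R * x ^+ (m - k)).
have T0 m : 0 <= T m by rewrite !mulr_ge0 ?g2_coef_ge0 ?ler0n ?exprn_ge0.
have -> : pseries (E k) x (2 * n) = \sum_(0 <= m < 2 * n + k) T m.
  rewrite (@big_cat_nat _ _ _ k) ?leq_addl //= big_nat_cond big1 ?add0r; last first.
    by move=> m /andP[/andP[_ mk] _]; rewrite /T ffact_small // mul0r mulr0.
  have -> : \sum_(k <= m < 2 * n + k) T m = \sum_(0 <= m < 2 * n) T (m + k)%N.
    by rewrite -{1}[k]add0n big_addn addnK.
  rewrite /pseries /series /=.
  by apply: eq_bigr => m _; rewrite iter_pseries_diffs /T addnK; ring.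
rewrite (@big_cat_nat _ _ _ (2 * n) _ (2 * n + k)) ?leq_addr //= lerDl.
by apply: sumr_ge0 => m _.
Qed.

(** Each partial sum is a polynomial, so its value at the end point is a limit of
    values that the derivative dominates. *)
Lemma g2_partial_le_lim k n : ((g2_partial k n r)%:E <= g2_deriv_sqrt c N k rho)%E.
Proof.
pose q : {poly R} := \sum_(N <= M < n | 0 < c M)
  (c M * ((2 * M) ^_ k)%:R) *: 'X^(2 * M - k).
have qE x : q.[x] = g2_partial k n x.
  rewrite /q horner_sum; apply: eq_bigr => M _.
  by rewrite hornerZ hornerXn mulrA.
have qr : q.[x]%:E @[x --> r^'-] --> (g2_partial k n r)%:E.
  rewrite -qE; apply: cvg_EFin; first exact: nearW.
  by apply: cvg_at_left_filter; apply: continuous_horner.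
rewrite -(cvg_lim _ qr) //; apply: lee_lim; [exact: cvgP qr | exact: cvg_g2_deriv |].
near=> x; rewrite /g2_deriv lee_fin qE; apply: g2_partial_le.
  by apply: ltW; near: x; apply: nbhs_left_gt; rewrite sqrtr_gt0.
by near: x; exact: nbhs_left_lt.
Unshelve. all: by end_near. Qed.

Lemma threshold_partial_le n : (1 <= N)%N ->
  ((\sum_(N <= M < n | 0 < c M) c M * threshold c M N rho)%:E
   <= g2_deriv_sqrt c N (2 * N - 2) rho * deriv_const%:E)%E.
Proof.
move=> hN; apply: le_trans (lee_wpmul2r _ (g2_partial_le_lim (2 * N - 2) n)); last first.
  by rewrite lee_fin deriv_const_ge0.
rewrite -EFinM lee_fin /g2_partial mulr_suml big_nat_cond [leRHS]big_nat_cond.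
apply: ler_sum => M /andP[/andP[NM _] cM]; rewrite -mulrA ler_wpM2l ?(ltW cM) //.
exact: threshold_bound.
Qed.

End DerivativeBound.

(** * The theorem *)

Theorem theorem1p3 (R : realType) (rho : R) (N : nat) (c : nat -> R)
    (g : R[i]^o -> R[i]^o)
    (hrho : 0 < rho)
    (hN : (1 <= N)%N)
    (hc : forall j : nat, (j < N)%N -> 0 < c j)
    (hg : analytic_series c N rho g)
    (hgc : {within closed_disc rho, continuous g}) :
  let S : \bar R :=
    (\sum_(N <= M <oo | (0 < c M)%R) (c M * threshold c M N rho)%:E)%E in
  let D : \bar R := g2_deriv_sqrt c N (2 * N - 2) rho in
  let kappa : R :=
    (2 ^+ (N - 1) * ((N - 1)`!)%:R ^+ 2)^-1
    * \sum_(j < N) ('C(N - 1, j) ^ 2)%:R * (rho ^+ (N - j - 1) / c j) in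
  (forall (A : 'M[R[i]]_N) (t : R),
     psd_over (closed_disc rho) A ->
     (S <= t%:E)%E ->
     psd_over setT
       (t%:C *: (\sum_(j < N) (c j)%:C *: hadamard_pow A j) - map_mx g A))
  /\ cvg (g2_deriv c N (2 * N - 2) x @[x --> (Num.sqrt rho)^'-])
  /\ (S <= D * kappa%:E)%E
  /\ ((D < +oo)%E ->
      cvgn (fun n : nat =>
              \sum_(N <= M < n | 0 < c M) c M * threshold c M N rho)).
Proof.
move=> S D kap; have term0 M : 0 < c M -> 0 <= c M * threshold c M N rho.
  by move=> cM; rewrite mulr_ge0 ?(ltW cM) // threshold_ge0 // ltW.
have term0E M : (N <= M)%N -> 0 < c M -> (0 <= (c M * threshold c M N rho)%:E)%E.
  by move=> _ cM; rewrite lee_fin term0.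
have bound n := threshold_partial_le hrho hc hg n hN.
split; [|split; [|split]].
- move=> A t [/psdmx_posform pA Arho] St; split=> //.
  apply/psdmx_posform.
  have Tt n : \sum_(N <= M < n | 0 < c M) c M * threshold c M N rho <= t.
    rewrite -lee_fin -sumEFin; apply: le_trans St.
    exact: (nneseries_lim_ge n term0E).
  apply: eq_posform (posform_series hrho hc hg hgc Tt pA Arho) => i j.
  rewrite !mxE summxE; congr (_ * _ - _).
  by apply: eq_bigr => k _; rewrite !mxE.
- exact: cvg_g2_deriv hrho hg _.
- apply: lime_le; first exact: is_cvg_nneseries.
  by apply: nearW => n; rewrite sumEFin; apply: bound.
move=> Dfin; apply: nondecreasing_is_cvgn.
  by apply: nondecreasing_series => M _; apply: term0.
exists (fine (D * kap%:E)) => _ [n _ <-].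
have D0 : (0 <= D)%E.
  have := g2_partial_le_lim hrho hg (2 * N - 2) 0.
  by rewrite /g2_partial big_geq.
rewrite -lee_fin fineK; first exact: bound.
by rewrite fin_numM // ge0_fin_numE.
Qed.
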